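(* Let the discrete Heisenberg group $H$ act via homeomorphisms on a compact metric space $(X,\rho)$. If $X$ is infinite, then there exists at least one nonexpansive $2D$-dimensional vertical group, i.e. there is a linear subspace $V\subset\mathbb R^{2D}$ of dimension $2D-1$ such that $V\times\mathbb R\subset\mathcal H$ is nonexpansive.
   Context: Let $D\ge 1$ be an integer and let $\{e_i,f_i\}_{i=1}^D$ be the standard basis of $\mathbb R^{2D}$. For $v=\sum_i(p_ie_i+q_if_i)$ and $\tilde v=\sum_i(\tilde p_ie_i+\tilde q_if_i)$ put $\omega(v,\tilde v)=\sum_{i=1}^D(p_i\tilde q_i-q_i\tilde p_i)$. The Heisenberg group is $\mathcal H=\{(v,u):v\in\mathbb R^{2D},u\in\mathbb R\}$ with operation $(v,u)\cdot(\tilde v,\tilde u)=(v+\tilde v,\,u+\tilde u+\tfrac12\omega(v,\tilde v))$ and neutral element $\mathbf 0=(0,0)$. The discrete Heisenberg group $H$ is the subgroup of $\mathcal H$ generated by $x_i=(e_i,0)$ and $y_i=(f_i,0)$, $i=1,\dots,D$. A vertical group is a (normal) subgroup of $\mathcal H$ of the form $V\times\mathbb R$ with $V\subset\mathbb R^{2D}$ a linear subspace; it is called $k$-dimensional if $\dim V=k-1$. For $r>0$ the dilation is $\delta_r(v,u)=(rv,r^2u)$. A metric $d$ on $\mathcal H$ is homogeneous if $d(gf,hf)=d(g,h)$ and $d(\delta_rg,\delta_rh)=r\,d(g,h)$ for all $g,h,f\in\mathcal H$, $r>0$. A homogeneous metric $d$ on $\mathcal H$ is fixed. For $A\subset\mathcal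 H$ and $t\ge0$, $A^t=\{g\in\mathcal H: d(g,A)\le t\}$, where $d(g,A)=\inf\{d(g,h):h\in A\}$. $H$ acts via homeomorphisms on $X$ means: there is a group action $(g,x)\mapsto gx$ of $H$ on $X$, $(g_1g_2)x=g_1(g_2x)$, with each map $x\mapsto gx$ a homeomorphism. For $A\subset\mathcal H$ and $x,y\in X$ put $\rho^A(x,y)=\sup\{\rho(gx,gy):g\in A\cap H\}$. A set $A\subset\mathcal H$ is expansive if there exist $\varepsilon>0$ and $t>0$ such that for all $x,y\in X$, $\rho^{A^t}(x,y)\le\varepsilon$ implies $x=y$; otherwise $A$ is nonexpansive. *)

(* Defs.v *)
From HB Require Import structures.
From mathcomp Require Import all_boot all_order all_algebra.
From mathcomp Require Import ring.
From mathcomp Require Import all_classical all_reals all_analysis.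

Set Implicit Arguments.
Unset Strict Implicit.
Unset Printing Implicit Defensive.

Import Order.TTheory GRing.Theory Num.Theory.

Local Open Scope classical_set_scope.
Local Open Scope ring_scope.

Section Heisenberg.
Variables (R : realType) (D : nat).

(* R^2D is 'rV[R]_(D + D): the first D coordinates are the p_i (basis e_i),
   the last D ones are the q_i (basis f_i). *)
Definition symplectic (v w : 'rV[R]_(D + D)) : R :=
  \sum_(i < D) (v 0 (lshift D i) * w 0 (rshift D i)
                - v 0 (rshift D i) * w 0 (lshift D i)).

Definition heisenberg : Type := ('rV[R]_(D + D) * R)%type.

HB.instance Definition _ := Choice.on heisenberg.

Definition heis_one : heisenberg := (0, 0).

Definition heis_mul (g h : heisenberg) : heisenberg :=
  (g.1 + h.1, g.2 + h.2 + 2^-1 * symplectic g.1 h.1).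

Definition heis_inv (g : heisenberg) : heisenberg := (- g.1, - g.2).

Lemma symplecticDl u v w : symplectic (u + v) w = symplectic u w + symplectic v w.
Proof.
by rewrite -big_split; apply: eq_bigr => i _ /=; rewrite !mxE; ring.
Qed.

Lemma symplecticDr u v w : symplectic u (v + w) = symplectic u v + symplectic u w.
Proof.
by rewrite -big_split; apply: eq_bigr => i _ /=; rewrite !mxE; ring.
Qed.

Lemma symplectic0v v : symplectic 0 v = 0.
Proof. by apply: big1 => i _; rewrite !mxE; ring. Qed.

Lemma symplecticv0 v : symplectic v 0 = 0.
Proof. by apply: big1 => i _; rewrite !mxE; ring. Qed.

Lemma symplecticNv v : symplectic (- v) v = 0.
Proof. by apply: big1 => i _; rewrite !mxE; ring. Qed.

Lemma symplecticvN v : symplectic v (- v) = 0.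
Proof. by apply: big1 => i _; rewrite !mxE; ring. Qed.

Lemma heis_mulA : associative heis_mul.
Proof.
move=> g h k; rewrite /heis_mul /= symplecticDl symplecticDr addrA.
by congr pair; ring.
Qed.

Lemma heis_mul1g : left_id heis_one heis_mul.
Proof.
by case=> v u; rewrite /heis_mul /= symplectic0v mulr0 addr0 !add0r.
Qed.

Lemma heis_mulg1 : right_id heis_one heis_mul.
Proof.
by case=> v u; rewrite /heis_mul /= symplecticv0 mulr0 !addr0.
Qed.

Lemma heis_mulVg : left_inverse heis_one heis_inv heis_mul.
Proof.
by case=> v u; rewrite /heis_mul /= symplecticNv mulr0 addr0 !addNr.
Qed.

Lemma heis_mulgV : right_inverse heis_one heis_inv heis_mul.
Proof.
by case=> v u; rewrite /heis_mul /= symplecticvN mulr0 addr0 !subrr.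
Qed.

HB.instance Definition _ := isGroup.Build heisenberg
  heis_mulA heis_mul1g heis_mulg1 heis_mulVg heis_mulgV.

Definition heis_x (i : 'I_D) : heisenberg := (delta_mx 0 (lshift D i), 0).
Definition heis_y (i : 'I_D) : heisenberg := (delta_mx 0 (rshift D i), 0).

Definition discrete_heisenberg_set : set heisenberg :=
  smallest [set S : set heisenberg | group_closed (mem S)] (range heis_x `|` range heis_y).

Lemma discrete_heisenberg_closed : group_closed (mem discrete_heisenberg_set).
Proof.
split=> [|g h /set_mem gH /set_mem hH]; apply/mem_set => S [Scl genS].
  exact/set_mem/(proj1 Scl).
apply/set_mem/(proj2 Scl); apply/mem_set; [exact: gH | exact: hH].
Qed.

Definition discrete_heisenberg : Type := set_type discrete_heisenberg_set.

HB.instance Definition _ := SubChoice.on discrete_heisenberg.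
HB.instance Definition _ := SubChoice_isSubGroup.Build
  heisenberg _ discrete_heisenberg discrete_heisenberg_closed.

Definition vertical_group (V : {vspace 'rV[R]_(D + D)}) : set heisenberg :=
  [set g | g.1 \in V].

Definition dilation (r : R) (g : heisenberg) : heisenberg :=
  (r *: g.1, r ^+ 2 * g.2).

Definition is_metric (T : Type) (d : T -> T -> R) : Prop :=
  [/\ forall x y, 0 <= d x y,
      forall x y, d x y = 0 <-> x = y,
      forall x y, d x y = d y x
    & forall x y z, d x z <= d x y + d y z].

Definition homogeneous_metric (d : heisenberg -> heisenberg -> R) : Prop :=
  [/\ is_metric d,
      forall f g h, d (g * f)%g (h * f)%g = d g h
    & forall r g h, 0 < r -> d (dilation r g) (dilation r h) = r * d g h].

(* The infimum is taken in \bar R, so that it is +oo when A is empty. *)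
Definition dist_to_set (d : heisenberg -> heisenberg -> R) (A : set heisenberg)
    (g : heisenberg) : \bar R :=
  ereal_inf [set (d g h)%:E | h in A].

Definition thickening (d : heisenberg -> heisenberg -> R) (A : set heisenberg)
    (t : R) : set heisenberg :=
  [set g | (dist_to_set d A g <= t%:E)%E].

End Heisenberg.

Definition homeomorphism (X Y : topologicalType) (f : X -> Y) : Prop :=
  exists f' : Y -> X,
    [/\ cancel f f', cancel f' f, continuous f & continuous f'].

Definition group_action (G : groupType) (X : Type) (act : G -> X -> X) : Prop :=
  (forall x, act 1%g x = x) /\
  (forall g h x, act (g * h)%g x = act g (act h x)).

Definition acts_by_homeomorphisms (G : groupType) (X : topologicalType)
    (act : G -> X -> X) : Prop :=
  group_action act /\ forall g, homeomorphism (act g).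

Section Expansive.
Variables (R : realType) (D : nat) (X : metricType R).
Variable d : heisenberg R D -> heisenberg R D -> R.
Variable act : discrete_heisenberg R D -> X -> X.

(* The supremum is taken in \bar R, so that it is -oo when no element of the
   discrete group lies in A. *)
Definition rho_set (A : set (heisenberg R D)) (x y : X) : \bar R :=
  ereal_sup [set (mdist (act g x) (act g y))%:E
            | g in [set g : discrete_heisenberg R D | A (val g)]].

Definition expansive (A : set (heisenberg R D)) : Prop :=
  exists eps t : R, [/\ 0 < eps, 0 < t &
    forall x y, (rho_set (thickening d A t) x y <= eps%:E)%E -> x = y].

Definition nonexpansive (A : set (heisenberg R D)) : Prop := ~ expansive A.

End Expansive.

(* Main.v *)
(* If every hyperplane [n^perp] gives an expansive vertical group, then every open half-space
   [dot v n < 0] determines points.  Modulo the center the group is abelian, so near a boundary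
   point a large Euclidean ball looks like a half-space; by compactness of the unit sphere some
   cylinder [ball x R] determines points: take a group element of minimal norm at which two points
   separate, translate it to the origin and pass to a limit.
   A cylinder is a finite set times the powers of a central element [z], so the generators
   propagate agreement along intervals of powers of [z] with a loss linear in the word length.  But
   [z^(n^2) = [a^n, b^n]] has word length [4n], so agreement on one long interval spreads to all
   powers of [z].  Hence a finite subset of the group determines points, and [X] is finite. *)
Require Import Defs.
From HB Require Import structures.
From mathcomp Require Import all_boot all_order all_algebra.
From mathcomp Require Import zify ring lra.
From mathcomp Require Import all_classical all_reals all_analysis.

Set Implicit Arguments.
Unset Strict Implicit.

Import Order.TTheory GRing.Theory Num.Theory.
Import numFieldNormedType.Exports.

Local Open Scope classical_set_scope.
Local Open Scope ring_scope.

(** * Limits along a free ultrafilter *)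

Lemma free_ultrafilter : exists U : set_system nat, UltraFilter U /\ \oo `<=` U.
Proof. exact: ultraFilterLemma. Qed.

(** A cluster point of an ultrafilter is a limit, so one ultrafilter on [nat] replaces every
    extraction of a subsequence. *)
Lemma compact_ultra_cvg (X : topologicalType) (A : set X) (U : set_system nat) (x : nat -> X) :
  UltraFilter U -> compact A -> (forall n, A (x n)) -> exists p : X, x @ U --> p.
Proof.
move=> UU cA Ax; have [|p [_ clp]] := cA (x @ U) (fmap_proper_filter x ultra_proper).
  exact: (@filterE _ U).
exists p => V pV; have [//|UVC] := in_ultra_setVsetC (x @^-1` V) UU.
by have [z []] := clp (~` V) V UVC pV.
Qed.

Lemma cvg_mdist (R : realType) (X : metricType R) (F : set_system nat)
    {FF : Filter F} (x y : nat -> X) (p q : X) :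
  x @ F --> p -> y @ F --> q -> mdist (x n) (y n) @[n --> F] --> mdist p q.
Proof.
move=> xp yq; apply/cvgrPdist_le => e e0.
have e20 : 0 < e / 2 by rewrite divr_gt0.
near=> n.
have /ltW xpn : mdist p (x n) < e / 2 by near: n; exact: metricType_numDomainType.cvgr_dist_lt.
have /ltW yqn : mdist q (y n) < e / 2 by near: n; exact: metricType_numDomainType.cvgr_dist_lt.
have h1 := metric_triangle p (x n) q; have h2 := metric_triangle (x n) (y n) q.
have h3 := metric_triangle (x n) p (y n); have h4 := metric_triangle p q (y n).
rewrite (metric_sym (x n) p) in h3; rewrite (metric_sym (y n) q) in h2.
rewrite ler_norml; lra.
Unshelve. all: by end_near. Qed.

(** * Sets of group elements that determine points *)

Section GroupAction.
Variables (R : realType) (G : groupType) (X : metricType R) (act : G -> X -> X).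
Hypotheses (cX : compact [set: X]) (hact : acts_by_homeomorphisms act).

Definition agree (eps : R) (A : set G) (x y : X) : Prop :=
  forall g, A g -> mdist (act g x) (act g y) <= eps.

(** Expansiveness at a fixed scale, without thickening. *)
Definition determines (eps : R) (A : set G) : Prop :=
  forall x y, agree eps A x y -> x = y.

Lemma act1 x : act 1%g x = x. Proof. exact: hact.1.1. Qed.

Lemma actM g h x : act (g * h)%g x = act g (act h x). Proof. exact: hact.1.2. Qed.

Lemma act_inj g : injective (act g).
Proof. by move=> x y /(congr1 (act g^-1%g)); rewrite -!actM mulVg !act1. Qed.

Lemma act_continuous g : continuous (act g).
Proof. by have [f' []] := hact.2 g. Qed.

Lemma agreeS eps A B x y : A `<=` B -> agree eps B x y -> agree eps A x y.
Proof. by move=> AB Bxy g /AB; exact: Bxy. Qed.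

Lemma cvg_mdist_act (U : set_system nat) {UU : Filter U} (x y : nat -> X) p q g :
    x @ U --> p -> y @ U --> q ->
  mdist (act g (x n)) (act g (y n)) @[n --> U] --> mdist (act g p) (act g q).
Proof.
move=> xp yq; apply: cvg_mdist.
  by apply: (cvg_comp _ _ xp); exact: act_continuous.
by apply: (cvg_comp _ _ yq); exact: act_continuous.
Qed.

(** If no [k] works, take a bad pair for each [k]. The limits agree on every [B k], because the
    [B k] increase and the bound is closed; hence they coincide, against the lower bound [delta]. *)
Lemma determines_local (eps delta : R) (B : nat -> set G) g :
    {homo B : m n / (m <= n)%N >-> m `<=` n} ->
    determines eps (\bigcup_k B k) -> 0 < delta ->
  exists k, forall x y, agree eps (B k) x y -> mdist (act g x) (act g y) <= delta.
Proof.
move=> homoB detB delta0; apply: contrapT => /forallNP noB.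
have {noB} /(_ _)/cid2 xy k : exists2 u : X * X, agree eps (B k) u.1 u.2 &
    delta < mdist (act g u.1) (act g u.2).
  apply: contrapT => noxy; apply: (noB k) => x y Bxy; rewrite leNgt; apply/negP => gxy.
  by apply: noxy; exists (x, y).
have [U [UU ooU]] := free_ultrafilter.
pose x k := (s2val (xy k)).1; pose y k := (s2val (xy k)).2.
have [p xp] := compact_ultra_cvg (x := x) UU cX (fun=> I).
have [q yq] := compact_ultra_cvg (x := y) UU cX (fun=> I).
have pq : p = q.
  apply: detB => h [k _ Bh].
  apply: (cvgr_to_le (cvg_mdist_act (g := h) xp yq)).
  apply: ooU; exists k => // n /= kn; apply: (s2valP (xy n)).
  exact: homoB Bh.
have := cvg_mdist_act (g := g) xp yq; rewrite pq mdistxx => /(_ _) gxy.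
have [n /= gn] := filter_ex (cvgr_lt _ gxy _ delta0).
by have := s2valP' (xy n); rewrite ltNge ltW.
Qed.

(** An injective sequence has an ultralimit [p]. Finitely many closeness conditions hold
    simultaneously near [p], so ultrafilter-many terms equal [p]. *)
Lemma finite_determines (eps : R) (A : set G) :
  0 < eps -> finite_set A -> determines eps A -> finite_set [set: X].
Proof.
move=> eps0 finA detA; apply: contrapT => /infiniteP/card_leP[f].
pose x (n : nat) : X := set_val (f (SigSub (mem_setT n))).
have xinj : injective x.
  move=> m n /val_inj/(inj (f := f)) mn.
  by have /(congr1 set_val) := mn (mem_setT _) (mem_setT _).
have [U [UU ooU]] := free_ultrafilter.
have [p xp] := compact_ultra_cvg (x := x) UU cX (fun=> I).
have [D AD] := finite_fsetP.1 finA.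
have agreeU : U (\bigcap_(g in A) [set n | mdist (act g (x n)) (act g p) <= eps]).
  rewrite AD; apply: filter_bigI => g _.
  have cstp : (fun=> p) @ U --> p by exact: cvg_cst.
  have := cvg_mdist_act (g := g) xp cstp.
  by rewrite mdistxx => /(_ _) gxp; exact: cvgr_le _ gxp _ eps0.
have xUp : U [set n | x n = p].
  by apply: filterS agreeU => n Dn; apply: detA => g /Dn.
have [m xm] := filter_ex xUp.
have [n [/= xn mn]] := filter_ex (filterI xUp (ooU _ (nbhs_infty_gt m))).
by move: mn; rewrite (xinj n m) ?ltnn// xn xm.
Qed.

End GroupAction.

(** * Distortion of a central commutator *)

Section CentralCommutator.
Local Open Scope group_scope.
Variable G : groupType.

Lemma commgX_central (a b : G) n :
  commute [~ a, b] b -> [~ a, b ^+ n] = [~ a, b] ^+ n.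
Proof.
move=> zb; suff : a * b ^+ n = b ^+ n * a * [~ a, b] ^+ n by rewrite commgC => /mulgI.
elim: n => [|n IHn]; first by rewrite !expg0 !mulg1 mul1g.
rewrite expgSr mulgA IHn -(mulgA (b ^+ n * a)) -(commuteX n (commute_sym zb)).
by rewrite mulgA -(mulgA _ a) (commgC a b) expgS !mulgA.
Qed.

Lemma commXX_central (a b : G) m n :
    commute [~ a, b] a -> commute [~ a, b] b ->
  [~ a ^+ m, b ^+ n] = [~ a, b] ^+ (m * n).
Proof.
move=> za zb; have zn : [~ a ^+ m, b] = [~ a, b] ^+ m.
  (* Inversion swaps the arguments of a commutator, which reduces to powers of the second one. *)
  apply: invg_inj; rewrite invgR commgX_central -?(invgR a b); last first.
    by apply/commute_sym/commuteV/commute_sym.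
  by rewrite expVgn.
rewrite commgX_central zn ?expgnA//.
by apply/commute_sym/commuteX/commute_sym.
Qed.

End CentralCommutator.

Section Distortion.
Variables (R : realType) (G : groupType) (X : metricType R) (act : G -> X -> X).
Hypotheses (cX : compact [set: X]) (hact : acts_by_homeomorphisms act).

Local Notation actM := (actM hact).

(** Premise and conclusion share the same [eps], so the implication can be iterated. *)
Lemma determines_finite_local (eps : R) (B : nat -> set G) (E : set G) :
    {homo B : m n / (m <= n)%N >-> m `<=` n} ->
    determines act eps (\bigcup_k B k) -> 0 < eps -> finite_set E ->
  exists k, forall x y, agree act eps (B k) x y -> agree act eps E x y.
Proof.
move=> homoB detB eps0 /finite_fsetP[D ED].
have : \oo (\bigcap_(g in E) [set k | forall x y, agree act eps (B k) x y ->
    mdist (act g x) (act g y) <= eps]).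
  rewrite ED; apply: filter_bigI => g _.
  have [k kB] := determines_local cX hact g homoB detB eps0.
  exists k => // m /= km x y Bm; apply: kB; exact: agreeS (homoB _ _ km) Bm.
by move=> /filter_ex[k kE]; exists k => x y Bk g /kE; apply.
Qed.

(** The right factor [c] is a translation: it amounts to replacing [x], [y] by [act c x],
    [act c y]. *)
Definition window (z : G) (T : set G) (c : G) (M : nat) : set G :=
  [set (t * z ^+ j * c)%g | t in T & j in `I_M].

Lemma window_finite z T c M : finite_set T -> finite_set (window z T c M).
Proof. by move=> finT; apply: finite_image2 => //; exact: finite_II. Qed.

Section Growth.
Variables (eps : R) (T : set G) (z : G) (N : nat).

(** The exponents of [z] in this window run from [-N] to [N]. *)
Definition propagates (e : G) := forall x y,
  agree act eps (window z T (z ^- N)%g N.*2.+1) x y -> agree act eps [set (t * e)%g | t in T] x y.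

Lemma propagate_step e c M x y : propagates e -> commute z e ->
    agree act eps (window z T c (M + N.*2)) x y ->
  agree act eps (window z T (z ^+ N * e * c)%g M) x y.
Proof.
move=> pe ze cxy _ [t Tt [j /= jM <-]].
have -> : (t * z ^+ j * (z ^+ N * e * c) = t * e * (z ^+ (N + j) * c))%g.
  rewrite -!mulgA; congr (_ * _)%g; rewrite !mulgA; congr (_ * _)%g.
  by rewrite -expgnDr addnC; exact/commute_sym/commuteX/commute_sym.
rewrite !(actM (t * e)%g); apply: pe; last by exists t.
move=> _ [s Ts [i /= iN <-]]; rewrite -!actM.
have -> : (s * z ^+ i * z ^- N * (z ^+ (N + j) * c) = s * z ^+ (i + j) * c)%g.
  by rewrite !expgnDr -!mulgA mulKg.
by apply: cxy; exists s => //; exists (i + j)%N => //=; lia.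
Qed.

Lemma propagate_steps e n c M x y : propagates e -> commute z e ->
    agree act eps (window z T c (M + n * N.*2)) x y ->
  agree act eps (window z T (z ^+ (n * N) * e ^+ n * c)%g M) x y.
Proof.
move=> pe ze; elim: n M => [|n IHn] M; first by rewrite mul0n addn0 !expg0 !mul1g.
rewrite mulSn addnA => /IHn/(propagate_step pe ze).
congr (agree _ _ (window _ _ _ _)).
rewrite mulSn expgnDr expgS -!mulgA; congr (_ * _)%g; rewrite !mulgA; congr (_ * _ * _)%g.
exact/commuteX/commute_sym.
Qed.

End Growth.

(* Spelling [z^(n^2)] as a word of length [4n] costs [8nN] in length and shifts the window by
   [4nN + n^2]; with [n = 4N + 1] the new right end exceeds the old one by [n]. *)
Lemma window_grows (eps : R) (T : set G) (a b : G) (N : nat) x y :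
    let z := [~ a, b]%g in
    commute z a -> commute z b ->
    (forall e, e \in [:: a; b; a^-1; b^-1]%g -> propagates eps T z N e) ->
    agree act eps (window z T 1%g ((4 * N).+1 * (8 * N).+1)) x y ->
  forall M, agree act eps (window z T 1%g M) x y.
Proof.
move=> z za zb pe.
have [pa pb] : propagates eps T z N a /\ propagates eps T z N b.
  by split; apply: pe; rewrite !inE eqxx ?orbT.
have [paV pbV] : propagates eps T z N a^-1%g /\ propagates eps T z N b^-1%g.
  by split; apply: pe; rewrite !inE eqxx ?orbT.
set n := (4 * N).+1.
(* Putting [b^n], [a^n], [b^-n], [a^-n] successively in front of [c] spells [[~ a^n, b^n] =
   z^(n*n)]. *)
have word c M : agree act eps (window z T c (M + 8 * n * N)) x y ->
    agree act eps (window z T (z ^+ (4 * n * N + n * n) * c)%g M) x y.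
  have -> : (M + 8 * n * N = M + n * N.*2 + n * N.*2 + n * N.*2 + n * N.*2)%N by lia.
  move=> /(propagate_steps pb zb)/(propagate_steps pa za).
  move=> /(propagate_steps pbV (commuteV zb))/(propagate_steps paV (commuteV za)).
  congr (agree _ _ (window _ _ _ _)).
  have zX e w : commute z e -> (e * (z ^+ (n * N) * w) = z ^+ (n * N) * (e * w))%g.
    by move=> ze; rewrite !mulgA; congr (_ * _)%g; apply/commuteX/commute_sym.
  have [zan zbn] := (commuteX n za, commuteX n zb).
  have [zVa zVb] := (commuteV zan, commuteV zbn).
  have -> : (4 * n * N = n * N + n * N + n * N + n * N)%N by lia.
  rewrite !expVgn -!mulgA !(zX _ _ zVa, zX _ _ zVb, zX _ _ zan).
  by rewrite !expgnDr -(commXX_central n n za zb) commgEl conjgE -!mulgA.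
move=> base; suff grow k : agree act eps (window z T 1%g ((8 * n * N + n) + k * n)) x y.
  move=> M; apply: agreeS (grow M) => _ [t Tt [j /= jM <-]].
  by exists t => //; exists j => //=; nia.
elim: k => [|k IHk].
  by apply: agreeS base => _ [t Tt [j /= jM <-]]; exists t => //; exists j => //=; nia.
move=> _ [t Tt [j /= jM <-]].
have [jk|kj] := ltnP j ((8 * n * N + n) + k * n).
  by apply: IHk; exists t => //; exists j.
(* As [n * n = 4nN + n], the shifted window starts at [8nN + n], no later than the old right end: no
   exponent is skipped. *)
apply: (word 1%g ((k + 1) * n)%N).
  by apply: agreeS IHk => _ [s Ts [i /= iM <-]]; exists s => //; exists i => //=; nia.
exists t => //; exists (j - (4 * n * N + n * n))%N => /=; first nia.
by rewrite !mulg1 -mulgA -expgnDr subnK//; nia.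
Qed.

(** Windows grow towards positive powers only. Exchanging [a] and [b] inverts [z] and covers the
    negative ones, so two one-sided windows suffice. *)
Lemma central_distortion (eps : R) (T : set G) (a b : G) :
    let z := [~ a, b]%g in
    0 < eps -> finite_set T -> commute z a -> commute z b ->
    determines act eps (\bigcup_k window z T (z ^- k)%g k.*2.+1) ->
  exists2 A, finite_set A & determines act eps A.
Proof.
move=> z eps0 finT za zb detT.
have homoW : {homo (fun k => window z T (z ^- k)%g k.*2.+1) : m n / (m <= n)%N >-> m `<=` n}.
  move=> m n mn _ [t Tt [j /= jm <-]]; exists t => //; exists (n - m + j)%N => /=; first lia.
  have -> : (z ^- n = z ^- (n - m) * z ^- m)%g by rewrite -invgM -expgnDr subnKC.
  by rewrite (addnC _ j) expgnDr !mulgA mulgK.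
have [|N codeN] := determines_finite_local
  (E := \bigcup_(e in [set` [:: a; b; a^-1; b^-1]%g]) [set (t * e)%g | t in T]) homoW detT eps0.
  by apply: bigcup_finite => // e _; exact: finite_image.
have pz e : e \in [:: a; b; a^-1; b^-1]%g -> propagates eps T z N e.
  by move=> he x y /codeN; apply: agreeS => _ [t Tt <-]; exists e => //; exists t.
have pzV e : e \in [:: b; a; b^-1; a^-1]%g -> propagates eps T [~ b, a]%g N e.
  move=> he x y Wxy; apply: pz; first by move: he; rewrite !inE => /or4P[] ->; rewrite ?orbT.
  (* The symmetric window is read backwards: position [j] becomes [2N - j] for the inverse of
     [z]. *)
  apply: agreeS Wxy => _ [t Tt [j /= jN <-]].
  exists t => //; exists (N.*2 - j)%N => /=; first by lia.
  rewrite -(invgR a b) -/z !expVgn invgK -!mulgA; congr (_ * _)%g.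
  apply: (mulgI (z ^+ (N.*2 - j))%g); rewrite mulVKg mulgA -expgnDr subnK; last by lia.
  by rewrite -addnn expgnDr mulgK.
have zV : [~ b, a]%g = z^-1%g by rewrite invgR.
pose M := ((4 * N).+1 * (8 * N).+1)%N.
exists (window z T 1%g M `|` window z^-1%g T 1%g M).
  by rewrite finite_setU; split; exact: window_finite.
move=> x y Axy; apply: detT => g [k _ [t Tt [j /= jk <-]]].
have [kj|/ltnW jk'] := leqP k j.
  apply: (window_grows (M := (j - k).+1) za zb pz (agreeS (@subsetUl _ _ _) Axy)).
  by exists t => //; exists (j - k)%N; rewrite //= mulg1 expgnFr// mulgA.
have [aVz bVz] : commute z^-1%g a /\ commute z^-1%g b.
  by split; apply/commute_sym/commuteV/commute_sym.
have grow := @window_grows eps T b a N x y; rewrite zV in grow pzV.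
apply: (grow bVz aVz pzV (agreeS (@subsetUr _ _ _) Axy) (k - j).+1).
by exists t => //; exists (k - j)%N; rewrite //= mulg1 expVgn expgnFr// invgM invgK mulgA.
Qed.

End Distortion.

(** * Hyperplanes and homogeneous metrics *)

Section Dot.
Variables (R : realType) (k : nat).
Implicit Types v w n : 'rV[R]_k.

Definition dot v n : R := \sum_i v 0 i * n 0 i.

Lemma dotDl v w n : dot (v + w) n = dot v n + dot w n.
Proof. by rewrite -big_split; apply: eq_bigr => i _; rewrite !mxE mulrDl. Qed.

Lemma dotNl v n : dot (- v) n = - dot v n.
Proof. by rewrite -sumrN; apply: eq_bigr => i _; rewrite !mxE mulNr. Qed.

Lemma dotC v w : dot v w = dot w v.
Proof. by apply: eq_bigr => i _; rewrite mulrC. Qed.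

Lemma dotDr v w n : dot v (w + n) = dot v w + dot v n.
Proof. by rewrite !(dotC v) dotDl. Qed.

Lemma dot_deltal i n : dot (delta_mx 0 i) n = n 0 i.
Proof.
rewrite /dot (bigD1 i)//= big1 ?mxE ?eqxx ?mul1r ?addr0// => j ji.
by rewrite mxE (negbTE ji) mul0r.
Qed.

Lemma dot_ge0 v : 0 <= dot v v.
Proof. by apply: sumr_ge0 => i _; rewrite -expr2 sqr_ge0. Qed.

Lemma coord_sqr_le_dot v i : v 0 i ^+ 2 <= dot v v.
Proof.
rewrite /dot (bigD1 i)//= -expr2 lerDl; apply: sumr_ge0 => j _.
by rewrite -expr2 sqr_ge0.
Qed.

(** A natural [m] satisfies [m <= m ^+ 2], which avoids a square root. *)
Lemma coord_le_of_dot_le v (m : nat) i : dot v v <= m%:R -> `|v 0 i| <= m%:R.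
Proof.
move=> vm; have := le_trans (coord_sqr_le_dot v i) vm; rewrite -real_normK ?num_real//.
have [->|m0] := posnP m; first by nra.
have : (1 : R) <= m%:R by rewrite ler1n.
nra.
Qed.

Lemma normr_dot_le v n (m : R) :
  (forall i, `|v 0 i| <= m) -> `|dot v n| <= m * \sum_i `|n 0 i|.
Proof.
move=> vm; rewrite (le_trans (ler_norm_sum _ _ _))// mulr_sumr.
by apply: ler_sum => i _; rewrite normrM ler_wpM2r.
Qed.

Definition dot_lfun n : 'Hom('rV[R]_k, 'M[R]_1) := linfun (mulmxr n^T).

Definition hyperplane n : {vspace 'rV[R]_k} := lker (dot_lfun n).

Lemma mem_hyperplane n v : (v \in hyperplane n) = (dot v n == 0).
Proof.
rewrite memv_ker lfunE/=; apply/eqP/eqP => [/matrixP/(_ 0 0)|vn].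
  by rewrite !mxE => vn; rewrite -[RHS]vn; apply: eq_bigr => i _; rewrite mxE.
apply/matrixP => a b; rewrite !mxE -[RHS]vn; apply: eq_bigr => i _.
by rewrite !ord1 mxE.
Qed.

Lemma dim_hyperplane n : n != 0 -> \dim (hyperplane n) = (k - 1)%N.
Proof.
move=> n0; have := limg_ker_dim (dot_lfun n) fullv.
rewrite capfv dimvf /dim/= mul1n.
have -> : \dim (limg (dot_lfun n)) = 1%N.
  apply/eqP; rewrite eqn_leq; apply/andP; split.
    by rewrite (leq_trans (dimvS (subvf _)))// dimvf.
  rewrite lt0n dimv_eq0; apply: contra n0 => /eqP limg0.
  apply/eqP/rowP => i; rewrite mxE -dot_deltal; apply/eqP.
  rewrite -mem_hyperplane memv_ker -memv0 -limg0; exact/memv_img/memvf.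
by move=> dimE; rewrite -[X in (X - 1)%N]dimE addnK.
Qed.

End Dot.

Section Heisenberg.
Variables (R : realType) (D : nat).
Implicit Types g h : heisenberg R D.

(** Nondegeneracy of the symplectic form: a linear functional becomes the height of a commutator,
    which the metric controls. *)
Lemma dot_symplectic (n : 'rV[R]_(D + D)) :
  exists w, forall v, dot v n = symplectic v w.
Proof.
exists (row_mx (- rsubmx n) (lsubmx n)) => v.
rewrite /dot big_split_ord/= /symplectic -big_split/=; apply: eq_bigr => i _ /=.
by rewrite row_mxEl row_mxEr !mxE mulrN opprK addrC; ring.
Qed.

Lemma heis_mulE g h : (g * h)%g = (g.1 + h.1, g.2 + h.2 + 2^-1 * symplectic g.1 h.1).
Proof. by []. Qed.

Lemma heis_invE g : (g^-1)%g = (- g.1, - g.2).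
Proof. by []. Qed.

Lemma symplecticNl (v w : 'rV[R]_(D + D)) : symplectic (- v) w = - symplectic v w.
Proof.
by apply/eqP; rewrite -addr_eq0 addrC -symplecticDl subrr symplectic0v.
Qed.

Lemma symplecticC (v w : 'rV[R]_(D + D)) : symplectic w v = - symplectic v w.
Proof. by rewrite -sumrN; apply: eq_bigr => i _; ring. Qed.

Lemma symplecticNr (v w : 'rV[R]_(D + D)) : symplectic v (- w) = - symplectic v w.
Proof. by rewrite symplecticC symplecticNl [in LHS]symplecticC !opprK. Qed.

Lemma heis_commgE g h : [~ g, h]%g = (0, symplectic g.1 h.1) :> heisenberg R D.
Proof.
rewrite /commg /conjg !(heis_mulE, heis_invE)/=; congr pair.
  by rewrite addrCA addrC !addrA addNr add0r subrr.
rewrite !(symplecticDl, symplecticDr, symplecticNl, symplecticNr) !(symplecticC g.1 h.1).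
have sxx v : symplectic v v = 0 :> R by apply: big1 => i _; ring.
rewrite !sxx; by field.
Qed.

Section HomogeneousNorm.
Variable d : heisenberg R D -> heisenberg R D -> R.
Hypothesis hd : homogeneous_metric d.

Lemma homogeneous_metric_mul g h : d (g * h)%g 1%g <= d g 1%g + d h 1%g.
Proof.
have [[_ _ _ tri] inv _] := hd.
by rewrite (le_trans (tri _ h _))// lerD2r -{2}(mul1g h) inv.
Qed.

Lemma homogeneous_metric_inv g : d (g^-1)%g 1%g = d g 1%g.
Proof.
have [[_ _ sym _] inv _] := hd.
by rewrite -(inv g) mulVg mul1g sym.
Qed.

(* The commutator of [g] and [(w, 0)] is [(0, symplectic g.1 w)], whose distance to the identity is
   proportional to the square root of its height. *)
Lemma symplectic_le_metric (w : 'rV[R]_(D + D)) (t : R) :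
  exists C, forall g, d g 1%g <= t -> `|symplectic g.1 w| <= C.
Proof.
have [[d0 deq0 _ _] _ dil] := hd.
pose c := d (0, 1) 1%g.
have c0 : 0 < c.
  rewrite lt_neqAle d0 andbT eq_sym; apply/eqP => /deq0 /(congr1 snd) /= /eqP.
  by rewrite oner_eq0.
(* For [s > 0], [(0, s)] is a dilate of [(0, 1)] by the square root of [s]; inversion gives
   [s < 0]. *)
have center (s : R) : d (0, s) 1%g = Num.sqrt `|s| * c.
  have pos r : 0 < r -> d (0, r) 1%g = Num.sqrt r * c.
    move=> r0; rewrite -dil ?sqrtr_gt0// /dilation/= scaler0 mulr1 sqr_sqrtr ?ltW//.
    by rewrite mulr0.
  have [s0|s0|->] := ltrgt0P s.
  - by rewrite pos.
  - rewrite -pos ?oppr_gt0// -(homogeneous_metric_inv (0, - s)) heis_invE/=.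
    by rewrite opprK oppr0.
  - by rewrite sqrtr0 mul0r; exact/deq0.
pose h : heisenberg R D := (w, 0).
exists (((t + d h 1%g) * 2 / c) ^+ 2) => g gt.
(* The commutator is a product of two letters as long as [g] and two as long as [h]. *)
have comm_le : Num.sqrt `|symplectic g.1 w| * c <= (t + d h 1%g) * 2.
  rewrite -center -(heis_commgE g h).
  have h1 := homogeneous_metric_mul g^-1%g (g ^ h)%g.
  have h2 := homogeneous_metric_mul h^-1%g (g * h)%g.
  have h3 := homogeneous_metric_mul g h.
  rewrite !homogeneous_metric_inv in h1 h2.
  rewrite commgEl conjgE in h1 *; lra.
rewrite -ler_pdivlMr// in comm_le.
rewrite -(sqr_sqrtr (normr_ge0 (symplectic g.1 w))).
by rewrite lerXn2r// nnegrE ?sqrtr_ge0// (le_trans _ comm_le) ?sqrtr_ge0.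
Qed.

(** By right invariance [g] differs from some [h] over the hyperplane by a factor of bounded length,
    and [h] does not contribute to the dot product. *)
Lemma thickening_hyperplane (n : 'rV[R]_(D + D)) (t : R) :
  exists C, forall g, thickening d (vertical_group (hyperplane n)) t g -> `|dot g.1 n| <= C.
Proof.
have [w nw] := dot_symplectic n.
have [C gC] := symplectic_le_metric w (t + 1).
exists C => g; rewrite /thickening/= /dist_to_set => gt.
(* The infimum need not be attained, hence [t + 1]. *)
have /ereal_inf_lt[_ [h Vh <-]] : (ereal_inf [set (d g h)%:E |
    h in vertical_group (hyperplane n)] < (t + 1)%:E)%E.
  by rewrite (le_lt_trans gt)// lte_fin ltrDl.
have [_ inv _] := hd.
rewrite lte_fin -(inv h^-1%g) mulgV => /ltW/gC.
move: Vh; rewrite /vertical_group/= mem_hyperplane => /eqP hn.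
by rewrite -nw dotDl dotNl hn subr0.
Qed.

End HomogeneousNorm.
End Heisenberg.

(** * The discrete Heisenberg group *)

Section DiscreteHeisenberg.
Variables (R : realType) (D : nat).
Local Notation H := (discrete_heisenberg R D).
Implicit Types g h : H.

Definition hproj g : 'rV[R]_(D + D) := (val g).1.

Lemma hprojM g h : hproj (g * h)%g = hproj g + hproj h.
Proof. by rewrite /hproj valM. Qed.

Lemma hproj1 : hproj 1%g = 0.
Proof. by rewrite /hproj val1. Qed.

Lemma hprojV g : hproj g^-1%g = - hproj g.
Proof. by apply/eqP; rewrite -addr_eq0 -hprojM mulVg hproj1. Qed.

(** The factor [1/2] in the product makes the heights half-integers. *)
Lemma discrete_heisenberg_int g :
  (forall i, hproj g 0 i \is a Num.int) /\ 2 * (val g).2 \is a Num.int.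
Proof.
pose S := [set u : heisenberg R D |
  (forall i, u.1 0 i \is a Num.int) /\ 2 * u.2 \is a Num.int].
suff : @discrete_heisenberg_set R D `<=` S by apply; exact/set_mem/(valP g).
move=> u; apply; split=> [|_ [[i _ <-]|[i _ <-]]]; last 2 first.
- by split=> [j|]; rewrite /= ?mulr0// mxE/= natr_int.
- by split=> [j|]; rewrite /= ?mulr0// mxE/= natr_int.
split=> [|a b /set_mem[a1 a2] /set_mem[b1 b2]]; apply/mem_set.
  by split=> [i|]; rewrite ?mxE ?mulr0.
split=> [i|] /=; first by rewrite !mxE rpredB.
rewrite !mulrDr mulrN mulrA divff ?pnatr_eq0// mul1r.
rewrite rpredD// ?rpredB// rpred_sum// => i _.
by rewrite !mxE rpredB ?rpredM ?rpredN.
Qed.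

(** This permits choosing a group element of minimal norm. *)
Lemma dot_proj_nat g : dot (hproj g) (hproj g) \is a Num.nat.
Proof.
apply: rpred_sum => i _; rewrite -expr2 natr_exp_even//.
exact: (discrete_heisenberg_int g).1.
Qed.

Lemma discrete_heisenberg_basis (i : 'I_(D + D)) :
  exists g, hproj g = delta_mx 0 i.
Proof.
have [j ->|j ->] := split_ordP i.
  have xH : heis_x R j \in @discrete_heisenberg_set R D.
    by apply/mem_set => S [_]; apply; left; exists j.
  by exists (insubd (1%g : H) (heis_x R j)); rewrite /hproj insubdK.
have yH : heis_y R j \in @discrete_heisenberg_set R D.
  by apply/mem_set => S [_]; apply; right; exists j.
by exists (insubd (1%g : H) (heis_y R j)); rewrite /hproj insubdK.
Qed.

(** Some basis vector pairs nontrivially with [n]; take a large power of its lift or of the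
    inverse. *)
Lemma dot_proj_unbounded (n : 'rV[R]_(D + D)) (C : R) :
  n != 0 -> exists g, dot (hproj g) n < C.
Proof.
move=> n0; have [i ni] : exists i, n 0 i != 0.
  apply: contrapT => /forallNP nn; move/eqP: n0; apply; apply/rowP => i.
  by rewrite mxE; apply/eqP/negPn/negP => /nn.
have [e ei] := discrete_heisenberg_basis i.
have dotX u m : dot (hproj (u ^+ m)%g) n = dot (hproj u) n *+ m.
  elim: m => [|m IHm]; first by rewrite expg0 hproj1 /dot big1// => j _; rewrite mxE mul0r.
  by rewrite expgS hprojM dotDl IHm mulrS.
have [u u0] : exists u, dot (hproj u) n < 0.
  have [n_lt0|n_gt0|/eqP] := ltrgt0P (n 0 i); last by rewrite (negbTE ni).
    by exists e^-1%g; rewrite hprojV dotNl ei dot_deltal oppr_lt0.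
  by exists e; rewrite ei dot_deltal.
have := archi_boundP (normr_ge0 (C / dot (hproj u) n)); set m := Num.bound _ => Cm.
exists (u ^+ m)%g; rewrite dotX -mulr_natr mulrC -ltr_ndivrMr//.
by rewrite (le_lt_trans _ Cm)// ler_norm.
Qed.

(** A commutator depends only on the projections, so any lifts of [e_i] and [f_i] serve. *)
Lemma central_generator (i : 'I_D) : exists a b : H, val [~ a, b]%g = (0, 1).
Proof.
have [a ai] := discrete_heisenberg_basis (lshift D i).
have [b bi] := discrete_heisenberg_basis (rshift D i).
exists a, b.
rewrite gmulfR heis_commgE; congr pair.
rewrite -/(hproj a) -/(hproj b) ai bi /symplectic (bigD1 i)//= big1 => [|j ji].
  by rewrite !mxE !eqxx/= eq_lrshift eq_rlshift mulr1 mulr0 subr0 addr0.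
by rewrite !mxE !eq_lrshift !eq_rlshift eq_lshift eq_rshift (negbTE ji)/= !mulr0 subr0.
Qed.

Lemma vertical_commute (z g : H) (u : R) : val z = (0, u) -> commute z g.
Proof.
move=> zE; apply: val_inj; rewrite !valM zE !heis_mulE/= symplectic0v symplecticv0.
by rewrite add0r addr0 mulr0 !addr0 addrC.
Qed.

End DiscreteHeisenberg.

(** * Cylinders over Euclidean balls *)

Section Cylinders.
Variables (R : realType) (D : nat).
Local Notation H := (discrete_heisenberg R D).
Implicit Types g h : H.

Definition cylinder (m : nat) : set H := [set g | dot (hproj g) (hproj g) <= m%:R].

Definition cylinder_slice (m : nat) : set H :=
  [set g | cylinder m g /\ `|(val g).2| <= 1].

(** Integers of [[-m, m]] are coded by [0, ..., 2m]. *)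
Lemma truncn_shift_inj (x y : R) (m : nat) :
    x \is a Num.int -> y \is a Num.int -> `|x| <= m%:R -> `|y| <= m%:R ->
  (inord (Num.truncn (x + m%:R)) : 'I_m.*2.+1) = inord (Num.truncn (y + m%:R)) ->
  x = y.
Proof.
have key (u : R) : u \is a Num.int -> `|u| <= m%:R ->
    (Num.truncn (u + m%:R) < m.*2.+1)%N /\ (Num.truncn (u + m%:R))%:R = u + m%:R.
  move=> uZ; rewrite ler_norml => /andP[mu um].
  have uN : u + m%:R \is a Num.nat by rewrite natrEint rpredD ?natr_int//=; lra.
  split; last by rewrite truncnK.
  by rewrite ltnS -(ler_nat R) truncnK// -addnn natrD lerD2r.
move=> xZ yZ /(key _ xZ)[xm xE] /(key _ yZ)[ym yE] /(congr1 val).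
by rewrite /= !inordK// => xy; apply: (addIr m%:R); rewrite -xE -yE xy.
Qed.

Lemma cylinder_slice_finite m : finite_set (cylinder_slice m).
Proof.
(* The doubled height is an integer of [[-2, 2]]. *)
pose code g : {ffun 'I_(D + D) -> 'I_m.*2.+1} * 'I_2.*2.+1 :=
  ([ffun i => inord (Num.truncn (hproj g 0 i + m%:R))],
   inord (Num.truncn (2 * (val g).2 + 2%:R))).
have code_inj : {in cylinder_slice m &, injective code}.
  move=> g h /set_mem[gm g1] /set_mem[hm h1] [/ffunP cE cz].
  have [gZ gz] := discrete_heisenberg_int g; have [hZ hz] := discrete_heisenberg_int h.
  have gh1 : hproj g = hproj h.
    apply/rowP => i; have := cE i; rewrite !ffunE; apply: truncn_shift_inj => //.
      exact: coord_le_of_dot_le.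
    exact: coord_le_of_dot_le.
  have gh2 : (val g).2 = (val h).2.
    apply: (mulfI (_ : 2%:R != 0 :> R)); first by rewrite pnatr_eq0.
    by apply: truncn_shift_inj cz => //; rewrite normrM ger0_norm//; lra.
  apply: val_inj; move: gh1 gh2; rewrite /hproj.
  by case: (val g) (val h) => [? ?] [? ?] /= -> ->.
rewrite -(eq_finite_set (inj_card_eq code_inj)); exact: finite_finset.
Qed.

Lemma cylinder_sub_windows (z : H) m : val z = (0, 1) ->
  cylinder m `<=` \bigcup_k window z (cylinder_slice m) (z ^- k)%g k.*2.+1.
Proof.
move=> zE g gm; have zX j : val (z ^+ j)%g = (0, j%:R).
  elim: j => [|j IHj]; first by rewrite expg0 val1.
  by rewrite expgS valM IHj zE heis_mulE/= addr0 symplectic0v mulr0 addr0 -natr1 addrC.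
have pz j : hproj (z ^+ j)%g = 0 by rewrite /hproj zX.
have [uf fu] := andP (floor_itv (val g).2).
rewrite intrD in fu.
have slice h : hproj h = hproj g -> `|(val h).2| <= 1 -> cylinder_slice m h.
  by move=> hg h1; split=> //; rewrite /cylinder/= hg.
(* Removing the floor of the height leaves a height in [[0, 1)]. A floor [j >= 0] is the last
   exponent of window [j]; a floor [-(j+1)] is the first of window [j+1]. *)
case fE : (Num.floor (val g).2) uf fu => [j|j] uf fu.
  exists j => //; exists (g * z ^- j)%g.
    apply: slice; first by rewrite hprojM hprojV pz oppr0 addr0.
    have VV : val (z ^- j)%g = (val (z ^+ j)%g)^-1%g by exact: gmulfV.
    rewrite valM VV zX heis_mulE heis_invE/= oppr0 symplecticv0 mulr0 addr0.
    by rewrite ler_norml; lra.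
  by exists j.*2 => /=; [lia | rewrite -addnn expgnDr !mulgA mulgVK mulgK].
exists j.+1 => //; exists (g * z ^+ j.+1)%g.
  apply: slice; first by rewrite hprojM pz addr0.
  rewrite valM zX heis_mulE/= symplecticv0 mulr0 addr0 ler_norml.
  rewrite NegzE mulrNz in uf fu. lra.
by exists 0%N => //=; rewrite expg0 mulg1 mulgK.
Qed.

End Cylinders.

(** * From expansive hyperplanes to a determining cylinder *)

Section Expansiveness.
Variables (R : realType) (D : nat).
Variable d : heisenberg R D -> heisenberg R D -> R.
Hypothesis hd : homogeneous_metric d.
Variables (X : metricType R) (act : discrete_heisenberg R D -> X -> X).
Hypotheses (cX : compact [set: X]) (hact : acts_by_homeomorphisms act).

Lemma rho_set_le (A : set (heisenberg R D)) (eps : R) x y :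
  agree act eps [set g | A (val g)] x y -> (rho_set act A x y <= eps%:E)%E.
Proof. by move=> Axy; apply: ge_ereal_sup => _ [g Ag <-]; rewrite lee_fin Axy. Qed.

(** Fixes the scale [eps]; the scales of other hyperplanes are compared with it by compactness. *)
Lemma expansive_determines A :
  expansive d act A -> exists2 eps : R, 0 < eps & determines act eps setT.
Proof.
move=> [eps [t [eps0 _ det]]]; exists eps => // x y xy.
by apply/det/rho_set_le => g _; exact: xy.
Qed.

Lemma cylinder_homo : {homo @cylinder R D : m n / (m <= n)%N >-> m `<=` n}.
Proof. by move=> m n mn g gm; rewrite /cylinder/= (le_trans gm)// ler_nat. Qed.

Lemma bigcup_cylinder : \bigcup_m cylinder m = [set: discrete_heisenberg R D].
Proof.
apply/seteqP; split=> // g _; exists (Num.bound (dot (hproj g) (hproj g))) => //.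
exact/ltW/archi_boundP/dot_ge0.
Qed.

(** Agreement within [eps] on a cylinder forces distance at most [delta] at the identity. The
    thickening lies in a strip, and some [h] pushes cylinder times strip into the half-space, so
    expansiveness applies to [act h x] and [act h y]. *)
Lemma halfspace_determines (eps : R) (n : 'rV[R]_(D + D)) :
    determines act eps setT -> n != 0 ->
    expansive d act (vertical_group (hyperplane n)) ->
  determines act eps [set g | dot (hproj g) n < 0].
Proof.
move=> det n0 [delta [t [delta0 _ detV]]] x y xy.
have [m local] : exists m, forall x y, agree act eps (cylinder m) x y ->
    mdist (act 1%g x) (act 1%g y) <= delta.
  by apply: (determines_local cX hact) => //; [exact: cylinder_homo | rewrite bigcup_cylinder].
have [C thickC] := thickening_hyperplane hd n t.
have [h hlt] := dot_proj_unbounded (- (C + m%:R * \sum_i `|n 0 i|)) n0.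
apply: (act_inj hact (g := h)); apply/detV/rho_set_le => g /= /thickC gC.
rewrite -[act g _](act1 hact) -[X in mdist _ X](act1 hact); apply: local => b bm.
rewrite -!(actM hact); apply: xy => /=; rewrite !hprojM !dotDl.
have := normr_dot_le n (fun i => coord_le_of_dot_le i bm).
move: gC; rewrite !ler_norml => /andP[_ gC] /andP[_ bC].
by rewrite /hproj in gC *; lra.
Qed.

Lemma dot_le_sqr_sum (k : nat) (v : 'rV[R]_k) : dot v v <= (\sum_i `|v 0 i|) ^+ 2.
Proof.
rewrite (le_trans (ler_norm _))// expr2 (@normr_dot_le _ _ v v)// => i.
by rewrite (bigD1 i)//= lerDl sumr_ge0.
Qed.

Lemma cylinder_determines (eps : R) :
    0 < eps -> determines act eps setT ->
    (forall n, n != 0 -> determines act eps [set g | dot (hproj g) n < 0]) ->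
  exists m, determines act eps (cylinder m).
Proof.
move=> eps0 det half; apply: contrapT => /forallNP nocyl.
(* The first component of [u] has minimal norm among the elements separating the pair. *)
have bad k : exists u : discrete_heisenberg R D * (X * X),
    [/\ eps < mdist (act u.1 u.2.1) (act u.1 u.2.2),
      k%:R < dot (hproj u.1) (hproj u.1) &
      forall h, dot (hproj h) (hproj h) < dot (hproj u.1) (hproj u.1) ->
        mdist (act h u.2.1) (act h u.2.2) <= eps].
  have [x [y [xy nexy]]] : exists x y, agree act eps (cylinder k) x y /\ x <> y.
    apply: contrapT => /forallNP no; apply: (nocyl k) => x y xy.
    by apply: contrapT => nexy; apply: (no x); exists y.
  pose P m := `[< exists2 g, dot (hproj g) (hproj g) = m%:R &
    eps < mdist (act g x) (act g y) >].
  have exP : exists m, P m.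
    apply: contrapT => noP; apply/nexy/det => g _; rewrite leNgt; apply/negP => gxy.
    have /natrP[m gm] := dot_proj_nat g.
    by apply: noP; exists m; apply/asboolP; exists g.
  have [m /asboolP[g gm gxy] minm] := ex_minnP exP.
  exists (g, (x, y)); split=> //=.
    by rewrite ltNge; apply/negP => /xy; rewrite leNgt gxy.
  move=> h; rewrite gm; have /natrP[l hl] := dot_proj_nat h.
  rewrite hl ltr_nat => lm; rewrite leNgt; apply/negP => hxy.
  have /minm : P l by apply/asboolP; exists h.
  by rewrite leqNgt lm.
have [u ubad] := choice bad.
pose g k := (u k).1; pose x k := act (g k) (u k).2.1; pose y k := act (g k) (u k).2.2.
(* Normalizing by the sum of absolute values puts the coordinates in [[-1, 1]] and keeps the norm of
   the limit equal to 1. *)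
pose s k := \sum_i `|hproj (g k) 0 i|.
have gs k : k%:R < s k ^+ 2.
  have [_ kg _] := ubad k; exact: lt_le_trans kg (dot_le_sqr_sum _).
have s_gt0 k : 0 < s k.
  rewrite lt_neqAle sumr_ge0 ?andbT//; apply/eqP => s0.
  by have := gs k; rewrite -s0 expr0n/= ltrn0.
have [U [UU ooU]] := free_ultrafilter.
have [p xp] := compact_ultra_cvg (x := x) UU cX (fun=> I).
have [q yq] := compact_ultra_cvg (x := y) UU cX (fun=> I).
have /choice[n nP] i : exists ni : R, hproj (g k) 0 i / s k @[k --> U] --> ni.
  apply: (compact_ultra_cvg UU (@segment_compact R (-1) 1)) => k.
  rewrite /= in_itv/= -ler_norml normrM normfV (gtr0_norm (s_gt0 k)) ler_pdivrMr// mul1r.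
  by rewrite /s (bigD1 i)//= lerDl sumr_ge0.
pose nv : 'rV[R]_(D + D) := \row_i n i.
have nv0 : nv != 0.
  apply/eqP => nv0.
  have : \sum_i `|hproj (g k) 0 i / s k| @[k --> U] --> \sum_i `|n i|.
    by apply: cvg_big => [|i _]; [exact: add_continuous | exact: cvg_norm].
  rewrite [X in _ --> X]big1 => [|i _]; last first.
    by have /rowP/(_ i) := nv0; rewrite !mxE => ->; rewrite normr0.
  move=> cvg0; have [k /=] := filter_ex (cvgr_lt _ cvg0 _ ltr01).
  under eq_bigr do rewrite normrM normfV (gtr0_norm (s_gt0 k)).
  by rewrite -mulr_suml -/(s k) divff ?gt_eqF// ltxx.
have dotP v : dot v (hproj (g k)) / s k @[k --> U] --> dot v nv.
  rewrite /dot; under [X in X @ _ --> _]funext do rewrite mulr_suml.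
  apply: cvg_big => [|i _]; first exact: add_continuous.
  by rewrite mxE; under [X in X @ _ --> _]funext do rewrite -mulrA; exact: cvgMr.
have pq : p = q.
  apply: (half nv nv0) => h /= hn.
  apply: (cvgr_to_le (cvg_mdist_act hact (g := h) xp yq)).
  (* Half of the limit, so that eventually the product of [h] with [g k] is below [- c * s k]. *)
  pose c : R := - dot (hproj h) nv / 2.
  have c0 : 0 < c by rewrite /c; lra.
  near=> k.
  have hk : dot (hproj h) (hproj (g k)) / s k < - c.
    by near: k; apply: (cvgr_lt _ (dotP _)); rewrite /c; lra.
  have sk : (dot (hproj h) (hproj h) / c) ^+ 2 < k%:R.
    by near: k; apply: ooU; exact: nbhs_infty_gtr.
  rewrite -!(actM hact); have [_ _] := ubad k; apply.
  (* The squared norm of [h * g k] exceeds that of [g k] by twice the dot product plus that of [h];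
     this is negative once the latter is below [c * s k], and minimality applies. *)
  rewrite !hprojM -/(g k) !(dotDl, dotDr) (dotC (hproj (g k)) (hproj h)).
  rewrite ltr_pdivrMr// in hk.
  have Qs : dot (hproj h) (hproj h) < s k * c.
    have Qc_ge0 : 0 <= dot (hproj h) (hproj h) / c by rewrite divr_ge0 ?dot_ge0 ?ltW.
    have s_ge0 : 0 <= s k by exact/ltW/s_gt0.
    by rewrite -ltr_pdivrMr// -(@ltr_pXn2r _ 2) ?nnegrE// (lt_trans sk (gs k)).
  by have := dot_ge0 (hproj h); lra.
have := cvg_mdist xp yq; rewrite pq mdistxx => /(_ _) xy0.
have [k /=] := filter_ex (cvgr_lt _ xy0 _ eps0).
by have [gk _ _] := ubad k; rewrite ltNge ltW.
Unshelve. all: by end_near. Qed.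

End Expansiveness.

Theorem theorem5p13 (R : realType) (D : nat) (hD : (1 <= D)%N)
  (d : heisenberg R D -> heisenberg R D -> R) (hd : homogeneous_metric d)
  (X : metricType R) (hX : compact [set: X])
  (act : discrete_heisenberg R D -> X -> X) (hact : acts_by_homeomorphisms act)
  (Xinf : infinite_set [set: X]) :
  exists V : {vspace 'rV[R]_(D + D)},
    \dim V = (2 * D - 1)%N /\ nonexpansive d act (vertical_group V).
Proof.
apply: contrapT => /forallNP noV; apply: Xinf.
have expV n : n != 0 -> expansive d act (vertical_group (hyperplane n)).
  move=> n0; apply: contrapT => nexp; apply: (noV (hyperplane n)); split=> //.
  by rewrite dim_hyperplane// mul2n addnn.
pose i0 : 'I_D := Ordinal hD.
have delta0 : delta_mx 0 (lshift D i0) != 0 :> 'rV[R]_(D + D).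
  by apply/eqP => /rowP/(_ (lshift D i0))/eqP; rewrite !mxE !eqxx oner_eq0.
have [eps eps0 det] := expansive_determines (expV _ delta0).
have [m cyl] := cylinder_determines hX hact eps0 det
  (fun n n0 => halfspace_determines hd hX hact det n0 (expV n n0)).
have [a [b zE]] := central_generator R i0.
have zC g := vertical_commute g zE.
(* The cylinder lies in the union of the windows over its finite slice, so these windows determine
   points too. *)
have [A finA detA] := central_distortion hX hact eps0 (cylinder_slice_finite R D m)
  (zC a) (zC b) (fun x y xy => cyl x y (agreeS (cylinder_sub_windows zE) xy)).
exact: (finite_determines hX hact eps0 finA detA).
Qed.
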